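(* Let $d\ge2$ be an integer and $0<\alpha<2$. Then for every $\theta=(\theta_1,\dots,\theta_d)\in\mathbb{R}^d$ with all coordinates nonzero, \[ A_d(\theta)=\frac{1}{(\alpha+1)\cdots(\alpha+d-1)}\sum_{\{j_k\}\in\mathscr{J}_1}\frac{1}{\theta_{j_2}\cdots\theta_{j_d}}\sum_{s_2,\dots,s_d=\pm1}s_2\cdots s_d\,(\theta_{j_1}+s_2\theta_{j_2}+\cdots+s_d\theta_{j_d})^{(d-1,\alpha)}, \] where $x^{(m,\alpha)}:=x^m|x|^\alpha$.
   Context: The function $A_d$ is \[ A_d(\theta):=\sum_{\{j_k\}\in\mathscr{J}_1}\frac{1}{\theta_{j_2}\cdots\theta_{j_d}}\int_{-\theta_{j_d}}^{\theta_{j_d}}\cdots\int_{-\theta_{j_2}}^{\theta_{j_2}}|\theta_{j_1}+\eta_2+\cdots+\eta_d|^\alpha\,d\eta_2\ldots d\eta_d, \] where $\mathscr{J}_1$ is the set of the $d$ sequences $\{j_1,\dots,j_d\}$ in which $j_1$ ranges over $1,\dots,d$ and $\{j_2,\dots,j_d\}$ is $\{1,\dots,d\}$ with $j_1$ removed, listed in increasing order. Integrals are oriented: $\int_{-a}^{a}$ with $a<0$ equals $-\int_{a}^{-a}$. *)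

(* Defs.v *)
From mathcomp Require Import all_boot all_order all_algebra.
From mathcomp Require Import all_classical all_reals all_analysis.

Set Implicit Arguments.
Unset Strict Implicit.
Unset Printing Implicit Defensive.

Import Order.TTheory GRing.Theory Num.Theory.
Import numFieldNormedType.Exports.

Local Open Scope classical_set_scope.
Local Open Scope ring_scope.

Definition oriented_int (R : realType) (a b : R) (f : R -> R) : R :=
  if a <= b then \int[lebesgue_measure]_(x in `[a, b]) f x
  else - \int[lebesgue_measure]_(x in `[b, a]) f x.

(* For s = [:: a_1; ...; a_m] this is
     \int_{-a_m}^{a_m} ... \int_{-a_1}^{a_1} f [:: x_1; ...; x_m] dx_1 ... dx_m:
   the head of s is the innermost integral. *)
Fixpoint iterated_int (R : realType) (s : seq R) (f : seq R -> R) : R :=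
  if s is a :: s' then
    iterated_int s' (fun xs => oriented_int (- a) a (fun x => f (x :: xs)))
  else f [::].

(* x^(m, alpha); powR satisfies 0 `^ alpha = 0 for alpha != 0. *)
Definition signed_pow (R : realType) (m : nat) (alpha x : R) : R :=
  x ^+ m * `|x| `^ alpha.

(* A member of J_1 is determined by its first index j; the remaining indices,
   listed in increasing order, are lift j k for k : 'I_d.-1. *)
Definition A (R : realType) (d : nat) (alpha : R) (theta : 'rV[R]_d) : R :=
  \sum_(j < d)
    (1 / \prod_(k < d.-1) theta 0 (lift j k)) *
    iterated_int [seq theta 0 (lift j k) | k : 'I_d.-1]
      (fun etas => `|theta 0 j + \sum_(eta <- etas) eta| `^ alpha).

(* Main.v *)
Require Import Defs.
From mathcomp Require Import all_boot all_order all_algebra.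
From mathcomp Require Import all_classical all_reals all_analysis.

Set Implicit Arguments.
Unset Strict Implicit.
Unset Printing Implicit Defensive.

Import Order.TTheory GRing.Theory Num.Theory.
Import numFieldNormedType.Exports.

Local Open Scope ring_scope.

(** The identity holds separately for each index [j]: it evaluates one iterated
    integral of [|c + eta_2 + ... + eta_d| `^ alpha] over a box centred at the
    origin.

    The function [x^(m+1, alpha)] is differentiable on the whole line, with
    derivative [(alpha + m + 1) x^(m, alpha)] ([is_derive_signed_pow]).  Hence
    the functions [F k x = x^(k, alpha) / ((alpha + 1) ... (alpha + k))] form a
    chain of successive antiderivatives that starts at [F 0 x = |x| `^ alpha].

    For any such chain, integrating [F 0 (c + eta_1 + ... + eta_m)] in [eta_1]
    from [- a] to [a] gives, by the fundamental theorem of calculus,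
    [G 0 (c + eta_2 + ... + eta_m)], where [G k x = F (k+1) (x + a) - F (k+1) (x - a)].
    Now [G] is again a chain of successive antiderivatives, so the same step
    applies to the next variable, and after [m] steps the symmetric differences
    expand into a sum over all sign vectors ([iterated_int_derivs]).  Carrying
    the whole chain through the induction keeps every integrand a single
    continuous function with a known antiderivative, instead of a growing sum of
    integrals to be split. *)

Lemma cvg_normr_powR0 (R : realType) (alpha : R) : 0 < alpha ->
  (`|x| `^ alpha @[x --> (0 : R)] --> (0 : R))%classic.
Proof.
move=> a0; apply/cvgr0Pnorm_lt => e e0.
exists (e `^ alpha^-1); first exact: powR_gt0.
move=> x /=; rewrite sub0r normrN => xe.
rewrite ger0_norm ?powR_ge0//.
(* The radius [e `^ alpha^-1] is the solution [r] of [r `^ alpha = e]. *)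
have -> : e = (e `^ alpha^-1) `^ alpha.
  by rewrite -powRrM mulVf ?powRr1 ?gt_eqF ?ltW.
by apply: gt0_ltr_powR; rewrite // nnegrE ?powR_ge0.
Qed.

Lemma cvg_signed_pow0 (R : realType) (m : nat) (alpha : R) : 0 < alpha ->
  (signed_pow m alpha x @[x --> (0 : R)] --> (0 : R))%classic.
Proof.
move=> a0; rewrite -[X in (_ --> X)%classic](mulr0 ((0 : R) ^+ m)).
exact: cvgM (@exprn_continuous _ m 0) (cvg_normr_powR0 a0).
Qed.

Lemma signed_powN (R : realType) (m : nat) (alpha x : R) :
  signed_pow m alpha (- x) = (-1) ^+ m * signed_pow m alpha x.
Proof. by rewrite /signed_pow normrN [(- x) ^+ m]exprNn -mulrA. Qed.

(** On the positive half-line [x^(m, alpha)] is the power [x `^ (alpha + m)],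
    whose derivative is known. *)
Lemma is_derive_signed_pow_gt0 (R : realType) (m : nat) (alpha x : R) : 0 < x ->
  is_derive x 1 (signed_pow m.+1 alpha)
    ((alpha + m.+1%:R) * signed_pow m alpha x).
Proof.
move=> x0.
have E k y : 0 < y -> y `^ (alpha + k%:R) = signed_pow k alpha y.
  move=> y0; rewrite powRD ?(gt_eqF y0) ?implybT//.
  by rewrite powR_mulrn ?ltW// /signed_pow mulrC gtr0_norm.
apply: (near_eq_is_derive (f := fun y => y `^ (alpha + m.+1%:R))).
  by near=> y; apply: E; near: y; exact: lt_nbhsr.
rewrite -E// (_ : alpha + m%:R = alpha + m.+1%:R - 1); last first.
  by rewrite -natr1 addrA addrK.
exact: is_derive1_powR.
Unshelve. all: by end_near.
Qed.

(** The points [x < 0] reduce to [- x > 0] because [x^(m, alpha)] has the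
    parity of [m].  At [0] the difference quotient of [x^(m+1, alpha)] is
    [x^(m, alpha)] itself, which tends to [0] since [alpha > 0]; this covers
    [m = 0], where the factor [|x| `^ alpha] need not be differentiable. *)
Lemma is_derive_signed_pow (R : realType) (m : nat) (alpha x : R) : 0 < alpha ->
  is_derive x 1 (signed_pow m.+1 alpha)
    ((alpha + m.+1%:R) * signed_pow m alpha x).
Proof.
move=> a0; have sp0 k : signed_pow k alpha 0 = 0.
  by rewrite /signed_pow normr0 powR0 ?gt_eqF// mulr0.
have [x0|x0|->] := ltgtP x 0; last 1 first.
- rewrite sp0 mulr0.
  set q := (fun h : R => h^-1 *: (signed_pow m.+1 alpha (h *: 1 + 0)
    - signed_pow m.+1 alpha 0)).
  have cq : (q h @[h --> (0 : R)^'] --> (0 : R))%classic.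
    apply: (@cvg_trans _ (signed_pow m alpha h @[h --> (0 : R)^'])%classic).
      apply: near_eq_cvg; near=> h; rewrite /q sp0 subr0 addr0 [h *: 1]mulr1.
      rewrite /signed_pow exprS -mulrA scalerA mulVf ?scale1r//.
      near: h; exact: nbhs_dnbhs_neq.
    exact: cvg_within_filter (cvg_signed_pow0 m a0).
  by apply: DeriveDef; [exact: cvgP cq|exact: cvg_lim cq].
- have -> : signed_pow m.+1 alpha =
      (-1) ^+ m.+1 \*: (signed_pow m.+1 alpha \o -%R).
    by apply/funext => y; rewrite -[in LHS](opprK y) signed_powN.
  have nx0 : 0 < - x by rewrite oppr_gt0.
  have dN := is_derive_signed_pow_gt0 m alpha nx0.
  apply: is_derive_eq.
  by rewrite signed_powN /GRing.scale /= exprS mulN1r mulrN1 mulrNN mulrCA signrMK.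
- exact: is_derive_signed_pow_gt0.
Unshelve. all: by end_near.
Qed.

Lemma is_derive_continuous (R : realType) (F f : R -> R) :
  (forall x : R, is_derive x 1 F (f x)) -> continuous F.
Proof.
by move=> dF x; apply/differentiable_continuous/derivable1_diffP.
Qed.

Lemma continuous_signed_pow0 (R : realType) (alpha : R) : 0 < alpha ->
  continuous (signed_pow 0 alpha).
Proof.
move=> a0 x; have [->|x0] := eqVneq x 0.
  rewrite /continuous_at [X in (_ --> X)%classic](_ : _ = 0).
    exact: cvg_signed_pow0.
  by rewrite /signed_pow normr0 powR0 ?gt_eqF// mulr0.
have -> : signed_pow 0 alpha = ((fun y => y `^ alpha) \o (fun y => `|y|)).
  by apply/funext => y; rewrite /signed_pow expr0 mul1r.
apply: continuous_comp; first exact: norm_continuous.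
apply/differentiable_continuous/derivable1_diffP.
by apply: derivable_powR; rewrite in_itv/= normr_gt0 x0.
Qed.

(** The orientation turns the case [b < a] into the opposite of the case
    [a < b], so the sides of the box may have any sign. *)
Lemma oriented_int_FTC (R : realType) (f F : R -> R) (a b : R) :
  continuous f -> (forall x : R, is_derive x 1 F (f x)) ->
  oriented_int a b f = F b - F a.
Proof.
move=> cf dF.
have FTC u v : u < v ->
    \int[lebesgue_measure]_(x in `[u, v]%classic) f x = F v - F u.
  move=> uv; rewrite /Rintegral (@continuous_FTC2 _ f F)//.
  - exact: continuous_subspaceT.
  - have cF := is_derive_continuous dF.
    split; [by []|apply: cvg_at_right_filter; exact: cF|apply: cvg_at_left_filter; exact: cF].
  - by move=> x _; rewrite derive1E; have [_ ->] := dF x.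
rewrite /oriented_int; have [ab|ba|->] := ltgtP a b.
- exact: FTC.
- by rewrite FTC// opprB.
- by rewrite set_itv1 Rintegral_set1 subrr.
Qed.

Lemma is_derive_shift_comp (R : realType) (F f : R -> R) (c x : R) :
  (forall y : R, is_derive y 1 F (f y)) ->
  is_derive x 1 (fun y => F (y + c)) (f (x + c)).
Proof.
move=> dF; rewrite -[f _]mulr1.
have dc : is_derive x (1 : R) (shift c) 1 by exact: is_derive_shift.
exact: (@is_derive1_comp _ F (shift c) x (f (x + c)) 1 (dF _) dc).
Qed.

(** A function on ['I_m.+1] amounts to its value at [ord0] together with its
    restriction along [lift ord0]; this peels the first sign off a sum over sign
    vectors. *)
Lemma sum_ffun_ordS (V : nmodType) (T : finType) (m : nat)
    (f : T -> {ffun 'I_m -> T} -> V) :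
  \sum_(s : {ffun 'I_m.+1 -> T}) f (s ord0) [ffun k => s (lift ord0 k)] =
  \sum_b \sum_(s : {ffun 'I_m -> T}) f b s.
Proof.
rewrite pair_big /=.
rewrite [RHS](reindex (fun s : {ffun 'I_m.+1 -> T} =>
  (s ord0, [ffun k => s (lift ord0 k)])))//=.
exists (fun p : T * {ffun 'I_m -> T} =>
  [ffun i : 'I_m.+1 => oapp p.2 p.1 (unlift ord0 i)]) => [s|[b s]] _ /=.
  apply/ffunP => i; rewrite ffunE.
  by case: unliftP => [j ->|->] //=; rewrite ffunE.
rewrite ffunE unlift_none; congr pair.
by apply/ffunP => i; rewrite !ffunE liftK.
Qed.

(** The induction integrates the innermost variable [t ord0] and replaces the
    chain [F] by its symmetric differences with step [t ord0], shifted by one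
    index; this is why [F] is a whole sequence rather than one function with its
    [m]-th antiderivative. *)
Lemma iterated_int_derivs (R : realType) (m : nat) (t : 'I_m -> R)
    (F : nat -> R -> R) (c : R) :
  continuous (F 0%N) ->
  (forall k (x : R), is_derive x 1 (F k.+1) (F k x)) ->
  iterated_int [seq t k | k : 'I_m] (fun xs => F 0%N (c + \sum_(x <- xs) x)) =
  \sum_(s : {ffun 'I_m -> bool}) (\prod_(k < m) (-1) ^+ s k) *
    F m (c + \sum_(k < m) (-1) ^+ s k * t k).
Proof.
elim: m t F => [|m IH] t F cF dF.
  rewrite /image_mem enum_ord0 /= big_nil.
  have s0 : {ffun 'I_0 -> bool} by exact: [ffun=> false].
  rewrite (big_pred1 s0); first by rewrite !big_ord0 mul1r.
  by move=> s; symmetry; apply/eqP/ffunP => -[].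
have -> : [seq t k | k : 'I_m.+1] = t ord0 :: [seq t (lift ord0 k) | k : 'I_m].
  by rewrite /image_mem enum_ordSl /= -map_comp.
rewrite /=.
pose G k x := F k.+1 (x + t ord0) - F k.+1 (x - t ord0).
have dG k (x : R) : is_derive x 1 (G k.+1) (G k x).
  by apply: is_deriveB; exact: is_derive_shift_comp.
have cG : continuous (G 0%N).
  apply: (@is_derive_continuous _ _
    (fun x => F 0%N (x + t ord0) - F 0%N (x - t ord0))).
  by move=> x; apply: is_deriveB; exact: is_derive_shift_comp.
have -> : (fun xs => oriented_int (- t ord0) (t ord0)
     (fun x => F 0%N (c + \sum_(y <- x :: xs) y))) =
   (fun xs => G 0%N (c + \sum_(x <- xs) x)).
  apply/funext => xs; set S := c + _.
  have -> : (fun x => F 0%N (c + \sum_(y <- x :: xs) y)) =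
      (fun x => F 0%N (x + S)).
    by apply/funext => x; rewrite big_cons addrCA.
  have dS (x : R) : is_derive x 1 (fun y : R => F 1%N (y + S)) (F 0%N (x + S)).
    exact: is_derive_shift_comp.
  have cS : continuous (fun x : R => F 0%N (x + S)).
    move=> x; apply: (@continuous_comp _ _ _ (shift S) (F 0%N)); last exact: cF.
    by apply: cvgD; [exact: cvg_id|exact: cvg_cst].
  by rewrite (oriented_int_FTC _ _ cS dS) /G [t _ + S]addrC [- t _ + S]addrC.
rewrite (IH _ G)//.
pose f (b : bool) (s : {ffun 'I_m -> bool}) := (-1) ^+ b *
  (\prod_(k < m) (-1) ^+ s k) *
  F m.+1 (c + ((-1) ^+ b * t ord0 + \sum_(k < m) (-1) ^+ s k * t (lift ord0 k))).
rewrite [RHS](_ : _ = \sum_b \sum_s f b s); last first.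
  rewrite -sum_ffun_ordS; apply: eq_bigr => s _.
  rewrite /f !big_ord_recl.
  by congr (_ * _ * F _ (c + (_ + _))); apply: eq_bigr => k _; rewrite ffunE.
(* The bit [true] stands for the sign [-1], hence for the subtracted term of [G]. *)
rewrite big_bool /= -big_split /=; apply: eq_bigr => s _.
rewrite /f /G expr1 expr0 !mulN1r !mul1r mulrBr addrC mulNr.
by rewrite -!addrA [t ord0 + _]addrC [- t ord0 + _]addrC.
Qed.

Lemma iterated_int_signed_pow (R : realType) (m : nat) (alpha : R)
    (t : 'I_m -> R) (c : R) : 0 < alpha ->
  iterated_int [seq t k | k : 'I_m]
    (fun xs => `|c + \sum_(x <- xs) x| `^ alpha) =
  1 / (\prod_(1 <= k < m.+1) (alpha + k%:R)) *
  \sum_(s : {ffun 'I_m -> bool}) (\prod_(k < m) (-1) ^+ s k) *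
    signed_pow m alpha (c + \sum_(k < m) (-1) ^+ s k * t k).
Proof.
move=> a0.
(* The constants make [F k.+1] an antiderivative of [F k]: the last factor of
   the product absorbs [alpha + k.+1%:R]. *)
pose F k x := (\prod_(1 <= i < k.+1) (alpha + i%:R))^-1 * signed_pow k alpha x.
have F0 x : F 0%N x = `|x| `^ alpha.
  by rewrite /F big_nil invr1 /signed_pow expr0 !mul1r.
have cF : continuous (F 0%N).
  have -> : F 0%N = signed_pow 0 alpha; last exact: continuous_signed_pow0.
  by apply/funext => x; rewrite F0 /signed_pow expr0 mul1r.
have dF k (x : R) : is_derive x 1 (F k.+1) (F k x).
  pose P := \prod_(1 <= i < k.+2) (alpha + i%:R).
  have -> : F k x = P^-1 *: ((alpha + k.+1%:R) * signed_pow k alpha x).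
    have -> : P = \prod_(1 <= i < k.+1) (alpha + i%:R) * (alpha + k.+1%:R).
      by rewrite /P big_nat_recr.
    rewrite /F invfM -[RHS]mulrA; congr (_ * _).
    by rewrite mulKf// gt_eqF// ltr_wpDr.
  exact: (is_deriveZ (f := signed_pow k.+1 alpha) P^-1
    (is_derive_signed_pow k x a0)).
under [X in iterated_int _ X]eq_fun do rewrite -F0.
rewrite iterated_int_derivs// mulr_sumr; apply: eq_bigr => s _.
by rewrite /F mulrCA div1r.
Qed.

Theorem theorem3 (R : realType) (d : nat) (hd : (2 <= d)%N)
  (alpha : R) (halpha0 : 0 < alpha) (halpha2 : alpha < 2)
  (theta : 'rV[R]_d) (htheta : forall i : 'I_d, theta 0 i != 0) :
  A alpha theta =
    1 / (\prod_(1 <= k < d) (alpha + k%:R)) *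
    \sum_(j < d)
      (1 / \prod_(k < d.-1) theta 0 (lift j k)) *
      \sum_(s : {ffun 'I_d.-1 -> bool})
        (\prod_(k < d.-1) (-1) ^+ s k) *
        signed_pow d.-1 alpha
          (theta 0 j + \sum_(k < d.-1) (-1) ^+ s k * theta 0 (lift j k)).
Proof.
rewrite /A mulr_sumr; apply: eq_bigr => j _.
by rewrite iterated_int_signed_pow// mulrCA prednK// ltnW.
Qed.
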